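(* Let $m,n,r$ be integers with $m,n,r\ge 2$ and $r\le \min(m,n)$. Let $A,B$ be generic binary forms of orders $m,n$, and let $\mathfrak u_k=(A,B)_k$ denote their $k$-th transvectant for $0\le k\le \min(m,n)$. Then there exist constants $c_{i,j}\in\mathbf Q$ such that $$\mathfrak u_r=\frac{1}{\mathfrak u_0}\sum_{\substack{0\le i\le j<r\\ i+j\le r}} c_{i,j}\,(\mathfrak u_i,\mathfrak u_j)_{r-i-j}.$$
   Context: Work over a field of characteristic zero. A binary form of order $d$ in $x_1,x_2$ is a homogeneous polynomial of degree $d$. For binary forms $F,G$ of orders $p,q$ and $0\le k\le\min(p,q)$, the $k$-th transvectant is the binary form of order $p+q-2k$ $$(F,G)_k=\frac{(p-k)!\,(q-k)!}{p!\,q!}\sum_{l=0}^k(-1)^l\binom kl\frac{\partial^kF}{\partial x_1^{k-l}\partial x_2^l}\,\frac{\partial^kG}{\partial x_1^l\partial x_2^{k-l}}.$$ In particular $(F,G)_0=FG$. ''Generic'' means $A=\sum_{k=0}^m\binom mk a_kx_1^{m-k}x_2^k$ and $B=\sum_{k=0}^n\binom nk b_kx_1^{n-k}x_2^k$, where the $a_k,b_k$ are independent indeterminates. Each $\mathfrak u_i$ is regarded as a binary form of order $m+n-2i$ in $x_1,x_2$ (with coefficients polynomial in the $a_k,b_k$), and $(\mathfrak u_i,\mathfrak u_j)_{r-i-j}$ is the transvectant with respect to $x_1,x_2$. *)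

(* Defs.v *)
From mathcomp Require Import all_boot all_order all_algebra.
From mathcomp Require Export mpoly.

Set Implicit Arguments.
Unset Strict Implicit.
Unset Printing Implicit Defensive.

Import GRing.Theory.
Local Open Scope ring_scope.

(* The variables x_1 and x_2 of binary forms, represented in {mpoly R[2]}. *)
Definition x1 : 'I_2 := ord0.
Definition x2 : 'I_2 := ord_max.

(* The orders p and q of F and G are explicit arguments, since they cannot be
   read off the zero form; the definition is meaningful for k <= minn p q and
   p`! and q`! invertible in R. *)
Definition transvectant (R : comUnitRingType) (p q k : nat)
    (F G : {mpoly R[2]}) : {mpoly R[2]} :=
  (((p - k)`! * (q - k)`!)%:R / (p`! * q`!)%:R : R) *:
  \sum_(l < k.+1) ((-1) ^+ l * 'C(k, l)%:R : R) *:
     (F^`M[U_(x1) *+ (k - l) + U_(x2) *+ l] *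
      G^`M[U_(x1) *+ l + U_(x2) *+ (k - l)]).

Section Generic.

Variables (K : fieldType) (m n : nat).

(* K[a_0, ..., a_m, b_0, ..., b_n]: the first m + 1 indeterminates are the a_k,
   the last n + 1 are the b_k. *)
Definition coefRing := {mpoly K[m.+1 + n.+1]}.

Definition coefA (k : 'I_m.+1) : coefRing := 'X_(lshift n.+1 k).
Definition coefB (k : 'I_n.+1) : coefRing := 'X_(rshift m.+1 k).

Definition genA : {mpoly coefRing[2]} :=
  \sum_(k < m.+1) ('C(m, k)%:R * coefA k) *:
     ('X_x1 ^+ (m - k) * 'X_x2 ^+ k).

Definition genB : {mpoly coefRing[2]} :=
  \sum_(k < n.+1) ('C(n, k)%:R * coefB k) *:
     ('X_x1 ^+ (n - k) * 'X_x2 ^+ k).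

Definition u_ (k : nat) : {mpoly coefRing[2]} := transvectant m n k genA genB.

(* (u_i, u_j)_k, where u_i is a form of order m + n - 2 i. *)
Definition uu_ (i j k : nat) : {mpoly coefRing[2]} :=
  transvectant (m + n - 2 * i) (m + n - 2 * j) k (u_ i) (u_ j).

(* A rational number as a scalar of the coefficient ring; it is the usual
   embedding when K has characteristic zero. *)
Definition ratC (c : rat) : coefRing := (ratr c : K)%:MP_[_].

End Generic.

(* Main.v *)
(* The classical symbolic method. A and B, written twice each, are four letters
   1, 2, 3, 4 with brackets [ab] and values a_x; a polynomial in them stands for
   a linear combination of products of derivatives of A, B, A, B. Then
   (u_i, u_j)_k is a rational multiple of the symbol [12]^i [34]^j tau^k with
   tau = [13] + [14] + [23] + [24], and by Euler's relation the factor a_x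
   multiplies the value of a symbol by a known integer.

   The symbol [13][24]([12] 3_x 4_x + [34] 1_x 2_x)^(r-2) changes sign when the
   letters 1 and 3, both standing for A, are exchanged, so its value is zero.
   Expanding the power leaves a relation between the values of
   [12]^i [34]^j [13][24], i + j = r - 2. By the syzygies between brackets, each
   of these is a rational combination of the values of [12]^i [34]^j times
   tau^2, [12] tau, [34] tau, [12]^2, [12][34] and [34]^2. Only i = 0 and j = 0
   involve u_0 u_r, with coefficients of the same sign, so the relation can be
   solved for u_0 u_r. *)
From HB Require Import structures.
Require Import Defs.
From mathcomp Require Import all_boot all_order all_algebra.
From mathcomp Require Import ring zify ssrcomplements.

Set Implicit Arguments.
Unset Strict Implicit.
Unset Printing Implicit Defensive.

Import Order.TTheory GRing.Theory Num.Theory.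
Local Open Scope ring_scope.

(** * The symbolic calculus *)

Section Umbral.

Variables (n : nat) (S : nzRingType) (h : 'X_{1..n} -> S).
Implicit Types P Q : {mpoly int[n]}.

(** The symbolic map of umbral calculus: a monomial stands for its value under [h], extended
    additively. Integer coefficients leave the target ring arbitrary. *)
Definition umbral P : S := \sum_(M <- msupp P) (P@_M)%:~R * h M.

Lemma umbral_wE P k : (msize P <= k)%N ->
  umbral P = \sum_(M : 'X_{1..n < k}) (P@_M)%:~R * h M.
Proof.
move=> le_Pk; set I : subFinType _ := 'X_{1..n < k}.
rewrite /umbral (big_mksub I) ?msupp_uniq //=; first last.
  by move=> M /msize_mdeg_lt /leq_trans; apply.
rewrite big_rmcond //= => M /memN_msupp_eq0 ->.
by rewrite mul0r.
Qed.

Fact umbral_is_zmod_morphism : zmod_morphism umbral.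
Proof.
move=> P Q.
pose k := maxn (msize (P - Q)) (maxn (msize P) (msize Q)).
rewrite !(@umbral_wE _ k) ?leq_max ?leqnn ?orbT //.
rewrite -sumrB; apply/eq_bigr => M _.
by rewrite raddfB /= rmorphB mulrBl.
Qed.

HB.instance Definition _ :=
  GRing.isZmodMorphism.Build {mpoly int[n]} S umbral umbral_is_zmod_morphism.

Lemma umbralX M : umbral 'X_[M] = h M.
Proof. by rewrite /umbral msuppX big_seq1 mcoeffX eqxx mul1r. Qed.

End Umbral.

(** Monomials generate the polynomials over the integers as an abelian group, so identities between
    additive maps can be checked on monomials. *)
Lemma mpoly_int_ind (n : nat) (K : {mpoly int[n]} -> Prop) :
    (forall P Q, K P -> K Q -> K (P - Q)) -> (forall M, K 'X_[M]) ->
  forall P, K P.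
Proof.
move=> KB KX P.
have K0 : K 0 by rewrite -(subrr 'X_[0%MM]); apply: KB.
have KN P1 : K P1 -> K (- P1) by rewrite -sub0r; apply: KB.
have KD P1 P2 : K P1 -> K P2 -> K (P1 + P2).
  by move=> K1 K2; rewrite -[P2]opprK; apply/KB/KN.
have KMn P1 k : K P1 -> K (P1 *+ k).
  by move=> K1; elim: k => [|k IHk]; rewrite ?mulr0n ?mulrS //; apply: KD.
rewrite [P]mpolyE; apply: big_ind => // M _.
rewrite -[P@_M]intz scaler_int; case: (P@_M) => k; first exact: KMn.
by rewrite NegzE mulrNz; apply/KN/KMn.
Qed.

Section Derivatives.

Variable (R : comNzRingType).
Implicit Types F G : {mpoly R[2]}.

Definition pd (e f : nat) F : {mpoly R[2]} :=
  F^`M[U_(x1) *+ e + U_(x2) *+ f].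

Lemma pd00 F : pd 0 0 F = F.
Proof. by rewrite /pd !mulm0n addm0 mderivm0m. Qed.

Lemma pdSl e f F : pd e.+1 f F = (pd e f F)^`M(x1).
Proof.
by rewrite /pd -mderivmU1m -mderivmDm mulmS [in RHS]addmC addmA.
Qed.

Lemma pdSr e f F : pd e f.+1 F = (pd e f F)^`M(x2).
Proof.
by rewrite /pd mulmSr -mderivmU1m -mderivmDm addmA.
Qed.

(** Cayley's Omega process: the transvectant without its factorial prefactor, meaningful over any
    commutative ring. *)
Definition omega k F G : {mpoly R[2]} :=
  \sum_(l < k.+1) (-1) ^+ l * 'C(k, l)%:R *
     (pd (k - l) l F * pd l (k - l) G).

End Derivatives.

(* Symbols of a pair of forms: the variables 0, 1 and 2, 3 stand for the partial
   derivatives of the first and of the second one. *)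
Local Notation "''o4' k" := (@Ordinal 4 k isT) (at level 8, k at level 0).
Local Notation "''o10' k" := (@Ordinal 10 k isT) (at level 8, k at level 0).

Section TwoLetters.

Variables (R : comNzRingType) (F G : {mpoly R[2]}).

Definition sym2 : {mpoly int[4]} -> {mpoly R[2]} :=
  umbral (fun M => pd (M 'o4 0) (M 'o4 1) F * pd (M 'o4 2) (M 'o4 3) G).

HB.instance Definition _ := GRing.Additive.on sym2.

Lemma sym2X M : sym2 'X_[M] =
  pd (M 'o4 0) (M 'o4 1) F * pd (M 'o4 2) (M 'o4 3) G.
Proof. exact: umbralX. Qed.

(** Leibniz rule: a derivative of the product falls on either letter. *)
Lemma sym2_deriv1 P : (sym2 P)^`M(x1) = sym2 (('X_('o4 0) + 'X_('o4 2)) * P).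
Proof.
elim/mpoly_int_ind: P => [P Q IHP IHQ|M]; first
  by rewrite mulrBr !raddfB /= IHP IHQ.
rewrite mulrDl -!mpolyXD raddfD /= !sym2X mderivM -!pdSl.
by rewrite !mnmDE !mnm1E /= !add0n !add1n.
Qed.

Lemma sym2_deriv2 P : (sym2 P)^`M(x2) = sym2 (('X_('o4 1) + 'X_('o4 3)) * P).
Proof.
elim/mpoly_int_ind: P => [P Q IHP IHQ|M]; first
  by rewrite mulrBr !raddfB /= IHP IHQ.
rewrite mulrDl -!mpolyXD raddfD /= !sym2X mderivM -!pdSr.
by rewrite !mnmDE !mnm1E /= !add0n !add1n.
Qed.

Lemma pd_sym2 e f P : pd e f (sym2 P) =
  sym2 (('X_('o4 0) + 'X_('o4 2)) ^+ e * ('X_('o4 1) + 'X_('o4 3)) ^+ f * P).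
Proof.
elim: e f => [|e IHe] f; last first.
  by rewrite pdSl IHe sym2_deriv1 exprS -!mulrA.
elim: f => [|f IHf]; first by rewrite pd00 !expr0 !mul1r.
by rewrite pdSr IHf sym2_deriv2 exprS expr0 !mul1r mulrA.
Qed.

Lemma sym2_monomial a b c d :
  sym2 ('X_('o4 0) ^+ a * 'X_('o4 1) ^+ b * 'X_('o4 2) ^+ c * 'X_('o4 3) ^+ d) =
  pd a b F * pd c d G.
Proof.
rewrite !mpolyXn -!mpolyXD sym2X.
by rewrite !mnmDE !mulmnE !mnm1E /= !mul0n !mul1n !addn0.
Qed.

(** The alternating sum in [omega] is the binomial expansion of a power of the bracket of the two
    letters. *)
Lemma omega_sym2 k : omega k F G =
  sym2 (('X_('o4 0) * 'X_('o4 3) - 'X_('o4 1) * 'X_('o4 2)) ^+ k).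
Proof.
rewrite exprBn raddf_sum; apply: eq_bigr => l _.
rewrite raddfMn /= -[in RHS]mulrA raddfMsign /= !exprMn mulr_natr mulrnAl;
  congr (_ * _ *+ _).
by rewrite -sym2_monomial; congr sym2; rewrite -!mulrA; congr (_ * _); ring.
Qed.

End TwoLetters.

Lemma prod_ord4 (T : comNzRingType) (E : 'I_4 -> T) :
  \prod_i E i = E 'o4 0 * E 'o4 1 * E 'o4 2 * E 'o4 3.
Proof.
rewrite !big_ord_recr big_ord0 /= mul1r.
by do !congr (_ * _); congr E; apply: val_inj.
Qed.

Lemma prod_ord10 (T : comNzRingType) (E : 'I_10 -> T) :
  \prod_i E i = E 'o10 0 * E 'o10 1 * E 'o10 2 * E 'o10 3 * E 'o10 4 *
                E 'o10 5 * E 'o10 6 * E 'o10 7 * E 'o10 8 * E 'o10 9.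
Proof.
rewrite !big_ord_recr big_ord0 /= mul1r.
by do !congr (_ * _); congr E; apply: val_inj.
Qed.

Lemma mul10_swap13 (T : comNzRingType) (a b c d e f g h i j : T) :
  a * b * c * d * e * f * g * h * i * j = e * f * c * d * a * b * g * h * i * j.
Proof. ring. Qed.

Lemma mul10_swap12_34 (T : comNzRingType) (a b c d e f g h i j : T) :
  a * b * c * d * e * f * g * h * i * j = e * f * g * h * a * b * c * d * i * j.
Proof. ring. Qed.

Lemma mderivXU (n : nat) (T : nzRingType) (i j : 'I_n) :
  ('X_i : {mpoly T[n]})^`M(j) = (i == j)%:R.
Proof.
rewrite mderivX mnm1E; case: eqP => [->|_]; last by rewrite scale0r.
rewrite scale1r -mpolyX0; congr 'X_[_].
by apply/mnmP => k; rewrite mnmBE mnm0E subnn.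
Qed.

Lemma mulX_mderivX (n : nat) (T : comNzRingType) (a : 'I_n) M :
  'X_a * ('X_[M])^`M(a) = (M a)%:R * 'X_[M] :> {mpoly T[n]}.
Proof.
rewrite mderivX -scalerAr -mpolyXD; case: (posnP (M a)) => [->|Ma_gt0].
  by rewrite scale0r mul0r.
rewrite addmC submK ?lep1mP -?lt0n // -mul_mpolyC.
by rewrite -mpolyC_nat.
Qed.

Section EulerScale.

Variables (T : comNzRingType) (x y u v w g h X Y N m : T).
Hypothesis E : x * u + y * v + N * w = m * w.

(** Euler's relation [E] inside a product of four forms: [w] is one factor, [u] and [v] its next
    derivatives. The four variants differ in the position of that factor. *)
Lemma euler_scale1 :
  x * X * Y * (u * g) * h + X * (y * Y) * (v * g) * h +
    N * (X * Y * (w * g) * h)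
  = m * (X * Y * (w * g) * h).
Proof.
transitivity (X * Y * g * h * (x * u + y * v + N * w)); first ring.
rewrite E; ring.
Qed.

Lemma euler_scale2 :
  x * X * Y * (g * u) * h + X * (y * Y) * (g * v) * h +
    N * (X * Y * (g * w) * h)
  = m * (X * Y * (g * w) * h).
Proof. by rewrite !(mulrC g) euler_scale1. Qed.

Lemma euler_scale3 :
  x * X * Y * h * (u * g) + X * (y * Y) * h * (v * g) +
    N * (X * Y * h * (w * g))
  = m * (X * Y * h * (w * g)).
Proof. by rewrite !(mulrAC _ h) euler_scale1. Qed.

Lemma euler_scale4 :
  x * X * Y * h * (g * u) + X * (y * Y) * h * (g * v) +
    N * (X * Y * h * (g * w))
  = m * (X * Y * h * (g * w)).
Proof. by rewrite !(mulrC g) euler_scale3. Qed.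

End EulerScale.

(** * Symbols in four letters and Euler's relation *)

Section FourLetters.

Variables (R : comNzRingType).
Implicit Types F G : {mpoly R[2]}.

(* Two variables for each of the four forms, and 8, 9 for x_1, x_2. *)
Definition sym4 F1 F2 F3 F4 : {mpoly int[10]} -> {mpoly R[2]} :=
  umbral (fun M =>
    'X_x1 ^+ M 'o10 8 * 'X_x2 ^+ M 'o10 9 *
    (pd (M 'o10 0) (M 'o10 1) F1 * pd (M 'o10 2) (M 'o10 3) F2) *
    (pd (M 'o10 4) (M 'o10 5) F3 * pd (M 'o10 6) (M 'o10 7) F4)).

HB.instance Definition _ F1 F2 F3 F4 := GRing.Additive.on (sym4 F1 F2 F3 F4).

Lemma sym4X F1 F2 F3 F4 M : sym4 F1 F2 F3 F4 'X_[M] =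
  'X_x1 ^+ M 'o10 8 * 'X_x2 ^+ M 'o10 9 *
  (pd (M 'o10 0) (M 'o10 1) F1 * pd (M 'o10 2) (M 'o10 3) F2) *
  (pd (M 'o10 4) (M 'o10 5) F3 * pd (M 'o10 6) (M 'o10 7) F4).
Proof. exact: umbralX. Qed.

Lemma sym4_monomial F1 F2 F3 F4 a b c d e f g h i j :
  sym4 F1 F2 F3 F4
    ('X_('o10 0) ^+ a * 'X_('o10 1) ^+ b * 'X_('o10 2) ^+ c * 'X_('o10 3) ^+ d *
     'X_('o10 4) ^+ e * 'X_('o10 5) ^+ f * 'X_('o10 6) ^+ g * 'X_('o10 7) ^+ h *
     'X_('o10 8) ^+ i * 'X_('o10 9) ^+ j) =
  'X_x1 ^+ i * 'X_x2 ^+ j * (pd a b F1 * pd c d F2) * (pd e f F3 * pd g h F4).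
Proof.
rewrite !mpolyXn -!mpolyXD sym4X.
rewrite !mnmDE !mulmnE !mnm1E /= !(mul0n, mul1n, add0n, addn0).
by rewrite mpolyXD -!mpolyXn.
Qed.

Definition emb12 : {mpoly int[4]} -> {mpoly int[10]} :=
  comp_mpoly [tuple 'X_('o10 0); 'X_('o10 1); 'X_('o10 2); 'X_('o10 3)].
Definition emb34 : {mpoly int[4]} -> {mpoly int[10]} :=
  comp_mpoly [tuple 'X_('o10 4); 'X_('o10 5); 'X_('o10 6); 'X_('o10 7)].
(** Exchanging letters is a substitution of variables, hence a ring morphism that can be computed
    bracket by bracket. *)
Definition swap13 : {mpoly int[10]} -> {mpoly int[10]} :=
  comp_mpoly [tuple 'X_('o10 4); 'X_('o10 5); 'X_('o10 2); 'X_('o10 3);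
                    'X_('o10 0); 'X_('o10 1); 'X_('o10 6); 'X_('o10 7);
                    'X_('o10 8); 'X_('o10 9)].
Definition swap12_34 : {mpoly int[10]} -> {mpoly int[10]} :=
  comp_mpoly [tuple 'X_('o10 4); 'X_('o10 5); 'X_('o10 6); 'X_('o10 7);
                    'X_('o10 0); 'X_('o10 1); 'X_('o10 2); 'X_('o10 3);
                    'X_('o10 8); 'X_('o10 9)].

HB.instance Definition _ := GRing.RMorphism.on emb12.
HB.instance Definition _ := GRing.RMorphism.on emb34.
HB.instance Definition _ := GRing.RMorphism.on swap13.
HB.instance Definition _ := GRing.RMorphism.on swap12_34.

(** Symbols in disjoint letters multiply: by biadditivity only monomials matter, and there both
    sides are the same product of derivatives. *)
Lemma sym4_emb F1 F2 F3 F4 P Q :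
  sym4 F1 F2 F3 F4 (emb12 P * emb34 Q) = sym2 F1 F2 P * sym2 F3 F4 Q.
Proof.
elim/mpoly_int_ind: P => [P1 P2 IH1 IH2|M].
  by rewrite !raddfB mulrBl raddfB /= IH1 IH2 mulrBl.
elim/mpoly_int_ind: Q => [P1 P2 IH1 IH2|N].
  by rewrite !raddfB mulrBr raddfB /= IH1 IH2 mulrBr.
rewrite /emb12 /emb34 !comp_mpolyX !prod_ord4 !(tnth_nth 0) /= !sym2X.
have := sym4_monomial F1 F2 F3 F4 (M 'o4 0) (M 'o4 1) (M 'o4 2) (M 'o4 3)
  (N 'o4 0) (N 'o4 1) (N 'o4 2) (N 'o4 3) 0 0.
by rewrite !expr0 !mulr1 !mul1r => <-; congr sym4; ring.
Qed.

(** Products of derivatives commute, so permuting letters permutes the forms; when [F1 = F3] the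
    value is unchanged. *)
Lemma sym4_swap13 F1 F2 F3 F4 P :
  sym4 F1 F2 F3 F4 (swap13 P) = sym4 F3 F2 F1 F4 P.
Proof.
elim/mpoly_int_ind: P => [P1 P2 IH1 IH2|M]; first by rewrite !raddfB /= IH1 IH2.
rewrite /swap13 comp_mpolyX prod_ord10 !(tnth_nth 0) /= sym4X.
rewrite mul10_swap13 sym4_monomial.
by move: (pd _ _ F1) (pd _ _ F2) (pd _ _ F3) (pd _ _ F4) => *; ring.
Qed.

Lemma sym4_swap12_34 F1 F2 F3 F4 P :
  sym4 F1 F2 F3 F4 (swap12_34 P) = sym4 F3 F4 F1 F2 P.
Proof.
elim/mpoly_int_ind: P => [P1 P2 IH1 IH2|M]; first by rewrite !raddfB /= IH1 IH2.
rewrite /swap12_34 comp_mpolyX prod_ord10 !(tnth_nth 0) /= sym4X.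
rewrite mul10_swap12_34 sym4_monomial.
by rewrite mulrAC.
Qed.

(** Euler's relation at the letter with variables [a], [b], when [M a + M b] derivatives of a form
    of order [m] are already taken; their contribution stands on the left to avoid a subtraction. *)
Definition euler_letter (Phi : {mpoly int[10]} -> {mpoly R[2]})
    (a b : 'I_10) (m : nat) :=
  forall M,
    Phi ('X_('o10 8) * 'X_a * 'X_[M]) + Phi ('X_('o10 9) * 'X_b * 'X_[M]) +
    (M a + M b)%:R * Phi 'X_[M] = m%:R * Phi 'X_[M].

Definition letter_degree (a b : 'I_10) (P : {mpoly int[10]}) (e : nat) :=
  'X_a * P^`M(a) + 'X_b * P^`M(b) = e%:R * P.

(** The factor a_x multiplies a value by the order left to its letter: Euler's operator counts
    [M a + M b] on each monomial, and homogeneity makes this count [e]. *)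
Lemma sym4_euler (Phi : {additive {mpoly int[10]} -> {mpoly R[2]}}) a b m P e :
  euler_letter Phi a b m -> letter_degree a b P e ->
  Phi (('X_('o10 8) * 'X_a + 'X_('o10 9) * 'X_b) * P) = (m%:R - e%:R) * Phi P.
Proof.
move=> PhiE Pe; apply/eqP; rewrite mulrBl eq_sym subr_eq eq_sym; apply/eqP.
rewrite [e%:R * _]mulr_natl -(raddfMn Phi) -[P *+ e]mulr_natl -Pe {e Pe}.
elim/mpoly_int_ind: P => [P1 P2 IH1 IH2|M].
  rewrite !(raddfB Phi) [in RHS]mulrBr -IH1 -IH2 !mderivB -!(raddfD Phi).
  by rewrite -(raddfB Phi); apply: (congr1 Phi); ring.
rewrite -PhiE !mulX_mderivX mulrDl (raddfD Phi); congr (_ + _).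
by rewrite -mulrDl -natrD !mulr_natl (raddfMn Phi).
Qed.

Definition euler_form m F :=
  'X_x1 * F^`M(x1) + 'X_x2 * F^`M(x2) = m%:R * F.

(** Differentiating the identity also hits the factor x_1 or x_2, which adds one copy of the
    derivative: each differentiation lowers the order by one. *)
Lemma euler_pd m F e f : euler_form m F ->
  'X_x1 * pd e.+1 f F + 'X_x2 * pd e f.+1 F + (e + f)%:R * pd e f F =
  m%:R * pd e f F.
Proof.
move=> Fm; elim: e f => [|e IHe] f; last first.
  have := congr1 (mderiv x1) (IHe f).
  rewrite !mulr_natl !raddfD !raddfMn /= !mderivM !mderivXU eqxx mul1r mul0r
    add0r -!pdSl => <-.
  by rewrite addSn mulrS; ring.
elim: f => [|f IHf]; first by rewrite pdSl pdSr !pd00 mul0r addr0.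
have := congr1 (mderiv x2) IHf.
rewrite !mulr_natl !raddfD !raddfMn /= !mderivM !mderivXU eqxx mul1r mul0r add0r
  -!pdSr.
rewrite !add0n => <-; rewrite mulrS; ring.
Qed.

Lemma sym4_euler1 m F1 F2 F3 F4 : euler_form m F1 ->
  euler_letter (sym4 F1 F2 F3 F4) ('o10 0) ('o10 1) m.
Proof.
move=> Fm M; rewrite -!mpolyXD !sym4X !mnmDE !mnm1E /= !(add0n, add1n).
rewrite !exprS; have := euler_pd (M 'o10 0) (M 'o10 1) Fm.
exact: euler_scale1.
Qed.

Lemma sym4_euler2 m F1 F2 F3 F4 : euler_form m F2 ->
  euler_letter (sym4 F1 F2 F3 F4) ('o10 2) ('o10 3) m.
Proof.
move=> Fm M; rewrite -!mpolyXD !sym4X !mnmDE !mnm1E /= !(add0n, add1n).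
rewrite !exprS; have := euler_pd (M 'o10 2) (M 'o10 3) Fm.
exact: euler_scale2.
Qed.

Lemma sym4_euler3 m F1 F2 F3 F4 : euler_form m F3 ->
  euler_letter (sym4 F1 F2 F3 F4) ('o10 4) ('o10 5) m.
Proof.
move=> Fm M; rewrite -!mpolyXD !sym4X !mnmDE !mnm1E /= !(add0n, add1n).
rewrite !exprS; have := euler_pd (M 'o10 4) (M 'o10 5) Fm.
exact: euler_scale3.
Qed.

Lemma sym4_euler4 m F1 F2 F3 F4 : euler_form m F4 ->
  euler_letter (sym4 F1 F2 F3 F4) ('o10 6) ('o10 7) m.
Proof.
move=> Fm M; rewrite -!mpolyXD !sym4X !mnmDE !mnm1E /= !(add0n, add1n).
rewrite !exprS; have := euler_pd (M 'o10 6) (M 'o10 7) Fm.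
exact: euler_scale4.
Qed.

End FourLetters.

(** The falling factorial x(x-1)...(x-n+1). It arises from n factors a_x, each of which raises the
    degree in its letter by one. *)
Fixpoint falling (T : nzRingType) (x : T) (n : nat) : T :=
  if n is n'.+1 then x * falling (x - 1) n' else 1.

(** * Symbols of the form [12]^i [34]^j [13][24] *)

(* For t_1, ..., t_4 = [13], [14], [23], [24], and up to the common factor
   [12]^i [34]^j: yab, sa, ra, ss, sr and rr are the values of t_a t_b,
   [12] t_a, [34] t_a, [12]^2, [12][34] and [34]^2;
   z1, ..., z6 are the values of the monomials [13]^2, [12][13], [34][13],
   [12]^2, [12][34], [34]^2 brought to degree 2 in each letter by factors a_x,
   and p, q, p', q' are the orders left to the four letters. *)
Section LinearAlgebra.

Variables (T : idomainType) (p q p' q' : T).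
Variables (y11 y22 y33 y44 y12 y13 y14 y23 y24 y34 s1 s2 s3 s4 r1 r2 r3 r4 : T).
Variables (ss sr rr z1 z2 z3 z4 z5 z6 : T).

Lemma quadratic_relation :
  p - q = p' - q' ->
  p * (p - 1) * q * (q - 1) * p' * (p' - 1) * q' * (q' - 1) != 0 ->
  q * (q - 1) * q' * (q' - 1) * y11 = z1 ->
  q * (q - 1) * p' * (p' - 1) * y22 = z1 + z3 *+ 2 + z6 ->
  p * (p - 1) * q' * (q' - 1) * y33 = z1 - z2 *+ 2 + z4 ->
  p * (p - 1) * p' * (p' - 1) * y44
    = z1 + z4 + z6 - z2 *+ 2 + z3 *+ 2 - z5 *+ 2 ->
  q * (q - 1) * (p' - 1) * (q' - 1) * y12 = z1 + z3 ->
  (p - 1) * (q - 1) * q' * (q' - 1) * y13 = z1 - z2 ->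
  (p - 1) * (q - 1) * (p' - 1) * (q' - 1) * y14 = z1 - z2 + z3 ->
  (p - 1) * (q - 1) * (p' - 1) * (q' - 1) * y23 = z1 - z2 + z3 - z5 ->
  (p - 1) * (q - 1) * p' * (p' - 1) * y24 = z1 - z2 + z3 *+ 2 - z5 + z6 ->
  p * (p - 1) * (p' - 1) * (q' - 1) * y34 = z1 - z2 *+ 2 + z3 - z5 + z4 ->
  (q - 1) * (p' - 1) * q' * (q' - 1) * s1 = z2 ->
  (q - 1) * p' * (p' - 1) * (q' - 1) * s2 = z2 + z5 ->
  (p - 1) * (p' - 1) * q' * (q' - 1) * s3 = z2 - z4 ->
  (p - 1) * p' * (p' - 1) * (q' - 1) * s4 = z2 + z5 - z4 ->
  (p - 1) * q * (q - 1) * (q' - 1) * r1 = z3 ->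
  (p - 1) * q * (q - 1) * (p' - 1) * r2 = z3 + z6 ->
  p * (p - 1) * (q - 1) * (q' - 1) * r3 = z3 - z5 ->
  p * (p - 1) * (q - 1) * (p' - 1) * r4 = z3 + z6 - z5 ->
  p' * (p' - 1) * q' * (q' - 1) * ss = z4 ->
  (p - 1) * (q - 1) * (p' - 1) * (q' - 1) * sr = z5 ->
  p * (p - 1) * q * (q - 1) * rr = z6 ->
  (p + q) * (p + q - 1) * (p + q - 2) *
    ((p' + q') * (p' + q' - 1) * (p' + q' - 2)) * y14 =
  p * q * p' * q' * (p + q - 2) * (p' + q' - 2) *
    (y11 + y22 + y33 + y44 + (y12 + y13 + y14 + y23 + y24 + y34) *+ 2)
  + (p - q) * p * q * (p + q - 1) * (p + q - 2) * (p' + q' - 1) *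
    (r1 + r2 + r3 + r4)
  - (p - q) * p' * q' * (p' + q' - 1) * (p' + q' - 2) * (p + q - 1) *
    (s1 + s2 + s3 + s4)
  - p * q * (p + q) * (p + q - 1) * (p + q - 2) * (p' + q') * rr
  - p' * q' * (p + q) * (p' + q') * (p' + q' - 1) * (p' + q' - 2) * ss
  + (q * q' *+ 2 + (p - q) * (q + q')) *
    ((p + q - 1) * (p + q - 2) * (p' + q' - 1) * (p' + q' - 2)) * sr.
Proof.
move=> pq K0 e11 e22 e33 e44 e12 e13 e14 e23 e24 e34 es1 es2 es3 es4
  er1 er2 er3 er4 ess esr err.
(* Every coefficient on the left of the hypotheses divides [K], so [K] times each value is a
   polynomial in the orders times a combination of [z1], ..., [z6]. *)
set K := (X in X != 0) in K0.
have Ky11 : K * y11 = p * (p - 1) * p' * (p' - 1) * z1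
  by rewrite -e11 /K; ring.
have Ky22 : K * y22 = p * (p - 1) * q' * (q' - 1) * (z1 + z3 *+ 2 + z6)
  by rewrite -e22 /K; ring.
have Ky33 : K * y33 = q * (q - 1) * p' * (p' - 1) * (z1 - z2 *+ 2 + z4)
  by rewrite -e33 /K; ring.
have Ky44 : K * y44 = q * (q - 1) * q' * (q' - 1) *
    (z1 + z4 + z6 - z2 *+ 2 + z3 *+ 2 - z5 *+ 2)
  by rewrite -e44 /K; ring.
have Ky12 : K * y12 = p * (p - 1) * p' * q' * (z1 + z3)
  by rewrite -e12 /K; ring.
have Ky13 : K * y13 = p * q * p' * (p' - 1) * (z1 - z2)
  by rewrite -e13 /K; ring.
have Ky14 : K * y14 = p * q * p' * q' * (z1 - z2 + z3)
  by rewrite -e14 /K; ring.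
have Ky23 : K * y23 = p * q * p' * q' * (z1 - z2 + z3 - z5)
  by rewrite -e23 /K; ring.
have Ky24 : K * y24 = p * q * q' * (q' - 1) * (z1 - z2 + z3 *+ 2 - z5 + z6)
  by rewrite -e24 /K; ring.
have Ky34 : K * y34 = q * (q - 1) * p' * q' * (z1 - z2 *+ 2 + z3 - z5 + z4)
  by rewrite -e34 /K; ring.
have Ks1 : K * s1 = p * (p - 1) * q * p' * z2
  by rewrite -es1 /K; ring.
have Ks2 : K * s2 = p * (p - 1) * q * q' * (z2 + z5)
  by rewrite -es2 /K; ring.
have Ks3 : K * s3 = p * q * (q - 1) * p' * (z2 - z4)
  by rewrite -es3 /K; ring.
have Ks4 : K * s4 = p * q * (q - 1) * q' * (z2 + z5 - z4)
  by rewrite -es4 /K; ring.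
have Kr1 : K * r1 = p * p' * (p' - 1) * q' * z3
  by rewrite -er1 /K; ring.
have Kr2 : K * r2 = p * p' * q' * (q' - 1) * (z3 + z6)
  by rewrite -er2 /K; ring.
have Kr3 : K * r3 = q * p' * (p' - 1) * q' * (z3 - z5)
  by rewrite -er3 /K; ring.
have Kr4 : K * r4 = q * p' * q' * (q' - 1) * (z3 + z6 - z5)
  by rewrite -er4 /K; ring.
have Kss : K * ss = p * (p - 1) * q * (q - 1) * z4
  by rewrite -ess /K; ring.
have Ksr : K * sr = p * q * p' * q' * z5
  by rewrite -esr /K; ring.
have Krr : K * rr = p' * (p' - 1) * q' * (q' - 1) * z6
  by rewrite -err /K; ring.
apply: (mulfI K0).
have linL c : c * (
  (p + q) * (p + q - 1) * (p + q - 2) *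
    ((p' + q') * (p' + q' - 1) * (p' + q' - 2)) * y14) =
  (p + q) * (p + q - 1) * (p + q - 2) *
    ((p' + q') * (p' + q' - 1) * (p' + q' - 2)) * (c * y14) by ring.
have linR c : c * (
  p * q * p' * q' * (p + q - 2) * (p' + q' - 2) *
    (y11 + y22 + y33 + y44 + (y12 + y13 + y14 + y23 + y24 + y34) *+ 2)
  + (p - q) * p * q * (p + q - 1) * (p + q - 2) * (p' + q' - 1) *
    (r1 + r2 + r3 + r4)
  - (p - q) * p' * q' * (p' + q' - 1) * (p' + q' - 2) * (p + q - 1) *
    (s1 + s2 + s3 + s4)
  - p * q * (p + q) * (p + q - 1) * (p + q - 2) * (p' + q') * rr
  - p' * q' * (p + q) * (p' + q') * (p' + q' - 1) * (p' + q' - 2) * ss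
  + (q * q' *+ 2 + (p - q) * (q + q')) *
    ((p + q - 1) * (p + q - 2) * (p' + q' - 1) * (p' + q' - 2)) * sr) =
  p * q * p' * q' * (p + q - 2) * (p' + q' - 2) *
    (c * y11 + c * y22 + c * y33 + c * y44 +
     (c * y12 + c * y13 + c * y14 + c * y23 + c * y24 + c * y34) *+ 2)
  + (p - q) * p * q * (p + q - 1) * (p + q - 2) * (p' + q' - 1) *
    (c * r1 + c * r2 + c * r3 + c * r4)
  - (p - q) * p' * q' * (p' + q' - 1) * (p' + q' - 2) * (p + q - 1) *
    (c * s1 + c * s2 + c * s3 + c * s4)
  - p * q * (p + q) * (p + q - 1) * (p + q - 2) * (p' + q') * (c * rr)
  - p' * q' * (p + q) * (p' + q') * (p' + q' - 1) * (p' + q' - 2) * (c * ss)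
  + (q * q' *+ 2 + (p - q) * (q + q')) *
    ((p + q - 1) * (p + q - 2) * (p' + q' - 1) * (p' + q' - 2)) * (c * sr)
  by ring.
rewrite linL linR Ky11 Ky22 Ky33 Ky44 Ky12 Ky13 Ky14 Ky23 Ky24 Ky34.
rewrite Ks1 Ks2 Ks3 Ks4 Kr1 Kr2 Kr3 Kr4 Kss Ksr Krr.
(* What remains is a polynomial identity that holds modulo p - q = p' - q'. *)
have -> : p = p' - q' + q by rewrite -pq; ring.
ring.
Qed.

End LinearAlgebra.

(** * Brackets of two letters, values a_x, and multidegrees *)

Definition br (a b c d : 'I_10) : {mpoly int[10]} := 'X_a * 'X_d - 'X_b * 'X_c.
Definition ev (a b : 'I_10) : {mpoly int[10]} :=
  'X_('o10 8) * 'X_a + 'X_('o10 9) * 'X_b.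

Local Notation br12 := (br ('o10 0) ('o10 1) ('o10 2) ('o10 3)).
Local Notation br13 := (br ('o10 0) ('o10 1) ('o10 4) ('o10 5)).
Local Notation br14 := (br ('o10 0) ('o10 1) ('o10 6) ('o10 7)).
Local Notation br23 := (br ('o10 2) ('o10 3) ('o10 4) ('o10 5)).
Local Notation br24 := (br ('o10 2) ('o10 3) ('o10 6) ('o10 7)).
Local Notation br34 := (br ('o10 4) ('o10 5) ('o10 6) ('o10 7)).
Local Notation ev1 := (ev ('o10 0) ('o10 1)).
Local Notation ev2 := (ev ('o10 2) ('o10 3)).
Local Notation ev3 := (ev ('o10 4) ('o10 5)).
Local Notation ev4 := (ev ('o10 6) ('o10 7)).

Lemma letter_degreeM a b P Q d e :
  letter_degree a b P d -> letter_degree a b Q e ->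
  letter_degree a b (P * Q) (d + e).
Proof.
rewrite /letter_degree => Pd Qe; rewrite !mderivM natrD mulrDl.
rewrite [in RHS]mulrA -Pd [e%:R * _]mulrCA -Qe; ring.
Qed.

Definition multidegree P (d : seq nat) :=
  [/\ letter_degree ('o10 0) ('o10 1) P (nth 0 d 0),
      letter_degree ('o10 2) ('o10 3) P (nth 0 d 1),
      letter_degree ('o10 4) ('o10 5) P (nth 0 d 2) &
      letter_degree ('o10 6) ('o10 7) P (nth 0 d 3)].

Lemma multidegreeM P Q d0 d1 d2 d3 e0 e1 e2 e3 :
  multidegree P [:: d0; d1; d2; d3] -> multidegree Q [:: e0; e1; e2; e3] ->
  multidegree (P * Q) [:: (d0 + e0)%N; (d1 + e1)%N; (d2 + e2)%N; (d3 + e3)%N].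
Proof.
by case=> P0 P1 P2 P3 [Q0 Q1 Q2 Q3]; split; apply: letter_degreeM.
Qed.

Lemma letter_degree1 a b : letter_degree a b 1 0.
Proof. by rewrite /letter_degree -mpolyC1 !mderivC !mulr0 mul0r addr0. Qed.

Lemma multidegree1 : multidegree 1 [:: 0; 0; 0; 0]%N.
Proof. by split; apply: letter_degree1. Qed.

Lemma multidegreeX P n d0 d1 d2 d3 : multidegree P [:: d0; d1; d2; d3] ->
  multidegree (P ^+ n) [:: (n * d0)%N; (n * d1)%N; (n * d2)%N; (n * d3)%N].
Proof.
move=> Pd; elim: n => [|n IHn]; first exact: multidegree1.
by rewrite exprS !mulSn; apply: multidegreeM.
Qed.

Ltac multidegree_gen :=
  rewrite /multidegree /letter_degree /br /ev !(mderivB, mderivD) !mderivM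
    !mderivXU /= !(mulr0, mul0r, mul1r, mulr1, addr0, add0r, subr0, sub0r,
      oppr0);
  split; try ring.

Lemma multidegree_br12 : multidegree br12 [:: 1; 1; 0; 0]%N.
Proof. multidegree_gen. Qed.

Lemma multidegree_br13 : multidegree br13 [:: 1; 0; 1; 0]%N.
Proof. multidegree_gen. Qed.

Lemma multidegree_br14 : multidegree br14 [:: 1; 0; 0; 1]%N.
Proof. multidegree_gen. Qed.

Lemma multidegree_br23 : multidegree br23 [:: 0; 1; 1; 0]%N.
Proof. multidegree_gen. Qed.

Lemma multidegree_br24 : multidegree br24 [:: 0; 1; 0; 1]%N.
Proof. multidegree_gen. Qed.

Lemma multidegree_br34 : multidegree br34 [:: 0; 0; 1; 1]%N.
Proof. multidegree_gen. Qed.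

Lemma multidegree_ev1 : multidegree ev1 [:: 1; 0; 0; 0]%N.
Proof. multidegree_gen. Qed.

Lemma multidegree_ev2 : multidegree ev2 [:: 0; 1; 0; 0]%N.
Proof. multidegree_gen. Qed.

Lemma multidegree_ev3 : multidegree ev3 [:: 0; 0; 1; 0]%N.
Proof. multidegree_gen. Qed.

Lemma multidegree_ev4 : multidegree ev4 [:: 0; 0; 0; 1]%N.
Proof. multidegree_gen. Qed.

(** * Reduction of [13][24] by the syzygies *)

Section Psi.

Variables (R : idomainType) (A B : {mpoly R[2]}) (m n : nat).
Hypotheses (Am : euler_form m A) (Bn : euler_form n B).

Local Notation Phi := (sym4 A B A B).

Lemma sym4_ev d0 d1 d2 d3 n1 n2 n3 n4 Q : multidegree Q [:: d0; d1; d2; d3] ->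
  Phi (ev1 ^+ n1 * (ev2 ^+ n2 * (ev3 ^+ n3 * (ev4 ^+ n4 * Q)))) =
  falling (m%:R - d0%:R) n1 * falling (n%:R - d1%:R) n2 *
  falling (m%:R - d2%:R) n3 * falling (n%:R - d3%:R) n4 * Phi Q.
Proof.
(* For a single letter: the innermost factor meets degree [d], the next one [d.+1], and so on. *)
have step a b N k Q' d : euler_letter Phi a b N -> letter_degree a b Q' d ->
    letter_degree a b (ev a b) 1 ->
    Phi (ev a b ^+ k * Q') = falling (N%:R - d%:R) k * Phi Q'.
  move=> HN; elim: k Q' d => [|k IHk] Q' d Q'd evd; first by rewrite !mul1r.
  have Q'd1 := letter_degreeM evd Q'd; rewrite add1n in Q'd1.
  rewrite exprSr -mulrA (IHk _ d.+1 Q'd1 evd).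
  have natrS1 : d.+1%:R = d%:R + 1 :> {mpoly R[2]} by rewrite mulrSr.
  have E := @sym4_euler R Phi a b N Q' d HN Q'd.
  rewrite /ev; rewrite E.
  by rewrite natrS1 opprD addrA mulrCA mulrA.
case=> Q1 Q2 Q3 Q4.
(* The factors belonging to other letters have degree 0 in the current letter and leave its degree
   unchanged. *)
have other k a b Q' : letter_degree a b Q' 0 ->
    forall e Q'', letter_degree a b Q'' e -> letter_degree a b (Q' ^+ k * Q'')
      e.
  move=> Q'0 e Q'' Q''e; elim: k => [|k IHk]; first by rewrite mul1r.
  by rewrite exprS -mulrA -[e]add0n; apply: letter_degreeM.
have [e11 e12 e13 e14] := multidegree_ev1.
have [e21 e22 e23 e24] := multidegree_ev2.
have [e31 e32 e33 e34] := multidegree_ev3.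
have [e41 e42 e43 e44] := multidegree_ev4.
rewrite (step _ _ _ _ _ _ (sym4_euler1 B A B Am) (other _ _ _ _ e21 _ _
  (other _ _ _ _ e31 _ _ (other _ _ _ _ e41 _ _ Q1))) e11).
rewrite (step _ _ _ _ _ _ (sym4_euler2 A A B Bn) (other _ _ _ _ e32 _ _
  (other _ _ _ _ e42 _ _ Q2)) e22).
rewrite (step _ _ _ _ _ _ (sym4_euler3 A B B Am) (other _ _ _ _ e43 _ _ Q3)
  e33).
rewrite (step _ _ _ _ _ _ (sym4_euler4 A B A Bn) Q4 e44).
by rewrite !mulrA.
Qed.

Section TwoBrackets.

Variables i j : nat.

Let Psi Q := Phi (br12 ^+ i * br34 ^+ j * Q).

Let PsiD Q1 Q2 : Psi (Q1 + Q2) = Psi Q1 + Psi Q2.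
Proof. by rewrite /Psi mulrDr (raddfD Phi). Qed.

Let PsiB Q1 Q2 : Psi (Q1 - Q2) = Psi Q1 - Psi Q2.
Proof. by rewrite /Psi mulrBr (raddfB Phi). Qed.

Let PsiMn Q k : Psi (Q *+ k) = Psi Q *+ k.
Proof. by rewrite /Psi mulrnAr (raddfMn Phi). Qed.

Variables p q p' q' : {mpoly R[2]}.
Hypotheses (Ep : p = m%:R - i%:R) (Eq : q = n%:R - i%:R).
Hypotheses (Ep' : p' = m%:R - j%:R) (Eq' : q' = n%:R - j%:R).

(** The common factor [12]^i [34]^j takes i derivatives from letters 1, 2 and j from letters 3, 4;
    what is left are the orders [p], [q], [p'], [q']. *)
Let Psi_ev d0 d1 d2 d3 n1 n2 n3 n4 Q : multidegree Q [:: d0; d1; d2; d3] ->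
  Psi (ev1 ^+ n1 * (ev2 ^+ n2 * (ev3 ^+ n3 * (ev4 ^+ n4 * Q)))) =
  falling (p - d0%:R) n1 * falling (q - d1%:R) n2 *
  falling (p' - d2%:R) n3 * falling (q' - d3%:R) n4 * Psi Q.
Proof.
move=> Qd; rewrite /Psi.
have := multidegreeM (multidegreeM (multidegreeX i multidegree_br12)
  (multidegreeX j multidegree_br34)) Qd.
rewrite !muln0 !muln1 !addn0 !add0n => /(sym4_ev n1 n2 n3 n4).
rewrite !natrD !opprD !addrA -Ep -Eq -Ep' -Eq' => <-; apply: (congr1 Phi).
by rewrite !(mulrCA (br12 ^+ i * br34 ^+ j)).
Qed.

Ltac syz :=
  rewrite /ev /br; move: ('X_('o10 0)) ('X_('o10 1)) ('X_('o10 2)) ('X_('o10 3))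
    ('X_('o10 4)) ('X_('o10 5)) ('X_('o10 6)) ('X_('o10 7)) ('X_('o10 8))
    ('X_('o10 9)) => *; ring.

(** The exponents complete a product of two brackets to degree 2 in each letter. The comparison then
    rests on syzygies such as [14] 3_x = [13] 4_x + [34] 1_x and [23] 1_x = [13] 2_x - [12] 3_x. *)
Ltac fact n1 n2 n3 n4 D :=
  have := Psi_ev n1 n2 n3 n4 D;
  rewrite /= !(subr0, mul1r, mulr1) !mulrA => <-;
  rewrite -?PsiMn -?(PsiD, PsiB); apply: (congr1 Psi); syz.

(** Completed to degree 2 in each letter, all products of two brackets are combinations of six
    symbols. The completions multiply values by known factors, and [quadratic_relation] eliminates
    the six. *)
Lemma Psi_br13_br24 :
  p * (p - 1) * q * (q - 1) * p' * (p' - 1) * q' * (q' - 1) != 0 ->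
  let tau := br13 + br14 + br23 + br24 in
  (p + q) * (p + q - 1) * (p + q - 2) *
    ((p' + q') * (p' + q' - 1) * (p' + q' - 2)) * Psi (br13 * br24) =
  p * q * p' * q' * (p + q - 2) * (p' + q' - 2) * Psi (tau ^+ 2)
  + (p - q) * p * q * (p + q - 1) * (p + q - 2) * (p' + q' - 1) *
    Psi (br34 * tau)
  - (p - q) * p' * q' * (p' + q' - 1) * (p' + q' - 2) * (p + q - 1) *
    Psi (br12 * tau)
  - p * q * (p + q) * (p + q - 1) * (p + q - 2) * (p' + q') * Psi (br34 ^+ 2)
  - p' * q' * (p + q) * (p' + q') * (p' + q' - 1) * (p' + q' - 2) *
    Psi (br12 ^+ 2)
  + (q * q' *+ 2 + (p - q) * (q + q')) *
    ((p + q - 1) * (p + q - 2) * (p' + q' - 1) * (p' + q' - 2)) *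
    Psi (br12 * br34).
Proof.
move=> K0 tau.
have tau2 : tau ^+ 2 = br13 * br13 + br14 * br14 + br23 * br23 + br24 * br24 +
    (br13 * br14 + br13 * br23 + br13 * br24 + br14 * br23 + br14 * br24
     + br23 * br24) *+ 2.
  by rewrite /tau; move: (br13) (br14) (br23) (br24) => *; ring.
have Psi_tau x : Psi (x * tau) =
    Psi (x * br13) + Psi (x * br14) + Psi (x * br23) + Psi (x * br24).
  by rewrite /tau !mulrDr !PsiD.
rewrite tau2 !(PsiD, PsiMn) !Psi_tau (expr2 br12) (expr2 br34).
apply: (@quadratic_relation _ p q p' q'
  (Psi (br13 * br13)) (Psi (br14 * br14)) (Psi (br23 * br23))
  (Psi (br24 * br24)) (Psi (br13 * br14)) (Psi (br13 * br23))
  (Psi (br13 * br24)) (Psi (br14 * br23)) (Psi (br14 * br24))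
  (Psi (br23 * br24)) (Psi (br12 * br13)) (Psi (br12 * br14))
  (Psi (br12 * br23)) (Psi (br12 * br24)) (Psi (br34 * br13))
  (Psi (br34 * br14)) (Psi (br34 * br23)) (Psi (br34 * br24))
  (Psi (br12 * br12)) (Psi (br12 * br34)) (Psi (br34 * br34))
  (Psi (ev2 ^+ 2 * ev4 ^+ 2 * (br13 * br13)))
  (Psi (ev2 * ev3 * ev4 ^+ 2 * (br12 * br13)))
  (Psi (ev1 * ev2 ^+ 2 * ev4 * (br34 * br13)))
  (Psi (ev3 ^+ 2 * ev4 ^+ 2 * (br12 * br12)))
  (Psi (ev1 * ev2 * ev3 * ev4 * (br12 * br34)))
  (Psi (ev1 ^+ 2 * ev2 ^+ 2 * (br34 * br34)))) => //.
(* Both differences of orders equal m - n. *)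
- by rewrite Ep Eq Ep' Eq'; ring.
- fact 0%N 2%N 0%N 2%N (multidegreeM multidegree_br13 multidegree_br13).
- fact 0%N 2%N 2%N 0%N (multidegreeM multidegree_br14 multidegree_br14).
- fact 2%N 0%N 0%N 2%N (multidegreeM multidegree_br23 multidegree_br23).
- fact 2%N 0%N 2%N 0%N (multidegreeM multidegree_br24 multidegree_br24).
- fact 0%N 2%N 1%N 1%N (multidegreeM multidegree_br13 multidegree_br14).
- fact 1%N 1%N 0%N 2%N (multidegreeM multidegree_br13 multidegree_br23).
- fact 1%N 1%N 1%N 1%N (multidegreeM multidegree_br13 multidegree_br24).
- fact 1%N 1%N 1%N 1%N (multidegreeM multidegree_br14 multidegree_br23).
- fact 1%N 1%N 2%N 0%N (multidegreeM multidegree_br14 multidegree_br24).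
- fact 2%N 0%N 1%N 1%N (multidegreeM multidegree_br23 multidegree_br24).
- fact 0%N 1%N 1%N 2%N (multidegreeM multidegree_br12 multidegree_br13).
- fact 0%N 1%N 2%N 1%N (multidegreeM multidegree_br12 multidegree_br14).
- fact 1%N 0%N 1%N 2%N (multidegreeM multidegree_br12 multidegree_br23).
- fact 1%N 0%N 2%N 1%N (multidegreeM multidegree_br12 multidegree_br24).
- fact 1%N 2%N 0%N 1%N (multidegreeM multidegree_br34 multidegree_br13).
- fact 1%N 2%N 1%N 0%N (multidegreeM multidegree_br34 multidegree_br14).
- fact 2%N 1%N 0%N 1%N (multidegreeM multidegree_br34 multidegree_br23).
- fact 2%N 1%N 1%N 0%N (multidegreeM multidegree_br34 multidegree_br24).
- fact 0%N 0%N 2%N 2%N (multidegreeM multidegree_br12 multidegree_br12).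
- fact 1%N 1%N 1%N 1%N (multidegreeM multidegree_br12 multidegree_br34).
- fact 2%N 2%N 0%N 0%N (multidegreeM multidegree_br34 multidegree_br34).
Qed.

End TwoBrackets.
End Psi.

(** The symbol tau. It is the bracket of the sum of letters 1, 2 with the sum of letters 3, 4. *)
Definition brsum := br13 + br14 + br23 + br24.

Lemma emb12X (i : 'I_4) : emb12 'X_i =
  [:: 'X_('o10 0); 'X_('o10 1); 'X_('o10 2); 'X_('o10 3)]`_i.
Proof. exact: comp_mpolyXU. Qed.

Lemma emb34X (i : 'I_4) : emb34 'X_i =
  [:: 'X_('o10 4); 'X_('o10 5); 'X_('o10 6); 'X_('o10 7)]`_i.
Proof. exact: comp_mpolyXU. Qed.

Lemma swap13X (i : 'I_10) : swap13 'X_i =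
  [:: 'X_('o10 4); 'X_('o10 5); 'X_('o10 2); 'X_('o10 3); 'X_('o10 0);
    'X_('o10 1); 'X_('o10 6); 'X_('o10 7); 'X_('o10 8); 'X_('o10 9)]`_i.
Proof. exact: comp_mpolyXU. Qed.

Lemma swap12_34X (i : 'I_10) : swap12_34 'X_i =
  [:: 'X_('o10 4); 'X_('o10 5); 'X_('o10 6); 'X_('o10 7); 'X_('o10 0);
    'X_('o10 1); 'X_('o10 2); 'X_('o10 3); 'X_('o10 8); 'X_('o10 9)]`_i.
Proof. exact: comp_mpolyXU. Qed.

(** * Iterated transvectants as symbols, and exchange of letters *)

Section Symmetries.

Variable (R : comNzRingType).
Implicit Types F G A B : {mpoly R[2]}.

Lemma omegaZ k (a b : R) F G :
  omega k (a *: F) (b *: G) = (a * b) *: omega k F G.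
Proof.
rewrite /omega scaler_sumr; apply: eq_bigr => l _.
by rewrite /pd !mderivmZ -scalerAl -!scalerAr scalerA.
Qed.

(** By the Leibniz rule, differentiating [omega i F1 F2] multiplies its symbol by the sum of letters
    1 and 2, and likewise for 3 and 4. The outer process is therefore a power of the bracket of the
    two sums. *)
Lemma omega_omega i j k F1 F2 F3 F4 :
  omega k (omega i F1 F2) (omega j F3 F4) =
  sym4 F1 F2 F3 F4 (br12 ^+ i * br34 ^+ j * brsum ^+ k).
Proof.
pose a1 : {mpoly int[10]} := 'X_('o10 0) + 'X_('o10 2).
pose a2 : {mpoly int[10]} := 'X_('o10 1) + 'X_('o10 3).
pose b1 : {mpoly int[10]} := 'X_('o10 4) + 'X_('o10 6).
pose b2 : {mpoly int[10]} := 'X_('o10 5) + 'X_('o10 7).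
have e12_1 : emb12 ('X_('o4 0) + 'X_('o4 2)) = a1.
  by rewrite (raddfD emb12) /= !emb12X.
have e12_2 : emb12 ('X_('o4 1) + 'X_('o4 3)) = a2.
  by rewrite (raddfD emb12) /= !emb12X.
have e34_1 : emb34 ('X_('o4 0) + 'X_('o4 2)) = b1.
  by rewrite (raddfD emb34) /= !emb34X.
have e34_2 : emb34 ('X_('o4 1) + 'X_('o4 3)) = b2.
  by rewrite (raddfD emb34) /= !emb34X.
have e12_br : emb12 ('X_('o4 0) * 'X_('o4 3) - 'X_('o4 1) * 'X_('o4 2)) = br12.
  by rewrite (rmorphB emb12) 2!(rmorphM emb12) /= !emb12X.
have e34_br : emb34 ('X_('o4 0) * 'X_('o4 3) - 'X_('o4 1) * 'X_('o4 2)) = br34.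
  by rewrite (rmorphB emb34) 2!(rmorphM emb34) /= !emb34X.
have -> : brsum = a1 * b2 - a2 * b1.
  rewrite /brsum /br /a1 /a2 /b1 /b2.
  move: ('X_('o10 0)) ('X_('o10 1)) ('X_('o10 2)) ('X_('o10 3))
    ('X_('o10 4)) ('X_('o10 5)) ('X_('o10 6)) ('X_('o10 7)) => *; ring.
rewrite (omega_sym2 F1) (omega_sym2 F3) (exprBn (a1 * b2)) mulr_sumr.
rewrite (raddf_sum (sym4 F1 F2 F3 F4)); apply: eq_bigr => l _.
rewrite [in RHS]mulrnAr (raddfMn (sym4 F1 F2 F3 F4)).
rewrite -(mulrA ((-1) ^+ l) (_ ^+ (k - l))) (mulrCA _ ((-1) ^+ l)).
rewrite (raddfMsign (sym4 F1 F2 F3 F4)).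
rewrite mulr_natr mulrnAl; congr (_ * _ *+ _).
rewrite !pd_sym2 -sym4_emb; congr (sym4 _ _ _ _ _).
have embX (f : {rmorphism {mpoly int[4]} -> {mpoly int[10]}}) x y z a b c :
    f (x ^+ a * y ^+ b * z ^+ c) = f x ^+ a * f y ^+ b * f z ^+ c.
  by rewrite !rmorphM !rmorphXn.
have emb12E x y z a b c :
    emb12 (x ^+ a * y ^+ b * z ^+ c) = emb12 x ^+ a * emb12 y ^+ b * emb12 z ^+
      c.
  exact: (embX emb12).
have emb34E x y z a b c :
    emb34 (x ^+ a * y ^+ b * z ^+ c) = emb34 x ^+ a * emb34 y ^+ b * emb34 z ^+
      c.
  exact: (embX emb34).
rewrite emb12E emb34E.
rewrite e12_1 e12_2 e12_br e34_1 e34_2 e34_br.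
rewrite !exprMn.
move: (br12) (br34) (a1) (a2) (b1) (b2) => s r c1 c2 d1 d2; ring.
Qed.

Lemma swap13_br13 : swap13 br13 = - br13.
Proof. by rewrite /br (rmorphB swap13) !(rmorphM swap13) /= !swap13X /=;
  ring. Qed.

Lemma swap13_br24 : swap13 br24 = br24.
Proof. by rewrite /br (rmorphB swap13) !(rmorphM swap13) /= !swap13X. Qed.

(** The exchange yields [14] 2_x 3_x - [23] 1_x 4_x. Expanding [14] 3_x and [23] 1_x by the
    syzygies, the two terms [13] 2_x 4_x cancel. *)
Lemma swap13_sum :
  swap13 (br12 * ev3 * ev4 + br34 * ev1 * ev2) =
  br12 * ev3 * ev4 + br34 * ev1 * ev2.
Proof.
rewrite /br /ev !(rmorphD swap13, rmorphN swap13, rmorphM swap13) /= !swap13X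
  /=.

move: ('X_('o10 0)) ('X_('o10 1)) ('X_('o10 2)) ('X_('o10 3))
    ('X_('o10 4)) ('X_('o10 5)) ('X_('o10 6)) ('X_('o10 7)) ('X_('o10 8))
    ('X_('o10 9)) => *; ring.
Qed.

(** The value equals its own negative, which over an arbitrary ring kills only its double. *)
Lemma sym4_antisym A B k :
  sym4 A B A B (br13 * br24 * (br12 * ev3 * ev4 + br34 * ev1 * ev2) ^+ k) *+ 2
  = 0.
Proof.
set P := br13 * _ * _.
have swapP : swap13 P = - P.
  rewrite /P 2!(rmorphM swap13) (rmorphXn swap13) /= swap13_br13 swap13_br24
    swap13_sum.
  by rewrite !mulNr.
by rewrite mulr2n -{1}sym4_swap13 swapP (raddfN (sym4 A B A B)) addNr.
Qed.

Lemma swap12_34_br12 : swap12_34 br12 = br34.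
Proof. by rewrite /br (rmorphB swap12_34) !(rmorphM swap12_34) /= !swap12_34X.
  Qed.

Lemma swap12_34_br34 : swap12_34 br34 = br12.
Proof. by rewrite /br (rmorphB swap12_34) !(rmorphM swap12_34) /= !swap12_34X.
  Qed.

(** Both brackets change sign. *)
Lemma swap12_34_br1324 : swap12_34 (br13 * br24) = br13 * br24.
Proof.
rewrite rmorphM /br !(rmorphB swap12_34) !(rmorphM swap12_34) /= !swap12_34X /=.
move: ('X_('o10 0)) ('X_('o10 1)) ('X_('o10 2)) ('X_('o10 3))
    ('X_('o10 4)) ('X_('o10 5)) ('X_('o10 6)) ('X_('o10 7)) => *; ring.
Qed.

Lemma swap12_34_brsum : swap12_34 brsum = - brsum.
Proof.
rewrite /brsum /br !(rmorphD swap12_34, rmorphN swap12_34, rmorphM swap12_34) /=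
  !swap12_34X /=.
move: ('X_('o10 0)) ('X_('o10 1)) ('X_('o10 2)) ('X_('o10 3))
    ('X_('o10 4)) ('X_('o10 5)) ('X_('o10 6)) ('X_('o10 7)) => *; ring.
Qed.

(** Up to factorials this is (u_i, u_j)_k = (-1)^k (u_j, u_i)_k: the exchange reverses the bracket
    tau and preserves the forms A, B, A, B. *)
Lemma sym4_brsum_sym A B i j k :
  sym4 A B A B (br12 ^+ i * br34 ^+ j * brsum ^+ k) =
  (-1) ^+ k * sym4 A B A B (br12 ^+ j * br34 ^+ i * brsum ^+ k).
Proof.
rewrite -sym4_swap12_34 2!(rmorphM swap12_34) 3!(rmorphXn swap12_34) /=.
rewrite swap12_34_br12 swap12_34_br34 swap12_34_brsum (exprNn brsum) (mulrCA _
  ((-1) ^+ k)).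
rewrite (raddfMsign (sym4 A B A B)).
by rewrite (mulrC (br34 ^+ i)).
Qed.

Lemma sym4_br1324_sym A B i j :
  sym4 A B A B (br12 ^+ i * br34 ^+ j * (br13 * br24)) =
  sym4 A B A B (br12 ^+ j * br34 ^+ i * (br13 * br24)).
Proof.
rewrite -sym4_swap12_34 2!(rmorphM swap12_34) 2!(rmorphXn swap12_34) /=
  swap12_34_br1324.
by rewrite swap12_34_br12 swap12_34_br34 (mulrC (br34 ^+ i)).
Qed.

End Symmetries.

Lemma binomial_sum_ends (V : nmodType) k (F : nat -> V) : (0 < k)%N ->
  \sum_(l < k.+1) F l *+ 'C(k, l) =
  F 0%N + \sum_(1 <= l < k) F l *+ 'C(k, l) + F k.
Proof.
move=> k_gt0; rewrite -(big_mkord xpredT (fun l => F l *+ 'C(k, l))).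
by rewrite big_nat_recr //= big_ltn // bin0 binn !mulr1n.
Qed.

(** * Rational combinations of the (u_i, u_j) *)

Section RationalSpan.

Variables (V : idomainType) (U : nat -> nat -> V) (r : nat).
Hypothesis natV : forall k, (k%:R == 0 :> V) = (k == 0%N).

(** The rational span, written with a common denominator [D] so that no division takes place in
    [V]. *)
Definition in_span (X : V) := exists D : nat, exists c : nat -> nat -> int,
  (0 < D)%N /\ D%:R * X =
    \sum_(i < r) \sum_(j < r | ((i <= j) && (i + j <= r))%N) (c i j)%:~R * U i
      j.

Definition is_int (x : V) := exists z : int, x = z%:~R.

Lemma is_int_nat k : is_int k%:R.
Proof. by exists k%:Z; rewrite pmulrn. Qed.

Lemma is_intD x y : is_int x -> is_int y -> is_int (x + y).
Proof. by case=> a -> [b ->]; exists (a + b); rewrite rmorphD. Qed.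

Lemma is_intN x : is_int x -> is_int (- x).
Proof. by case=> a ->; exists (- a); rewrite rmorphN. Qed.

Lemma is_intM x y : is_int x -> is_int y -> is_int (x * y).
Proof. by case=> a -> [b ->]; exists (a * b); rewrite rmorphM. Qed.

Lemma is_int1 : is_int 1. Proof. exact: (is_int_nat 1). Qed.

Lemma is_intMn x k : is_int x -> is_int (x *+ k).
Proof. by move=> x_int; rewrite -mulr_natl; apply/is_intM/x_int/is_int_nat. Qed.

Lemma is_int_falling x k : is_int x -> is_int (falling x k).
Proof.
elim: k x => [|k IHk] x x_int /=; first exact: is_int1.
by apply: is_intM => //; apply/IHk/is_intD/is_intN/is_int1.
Qed.

Lemma in_spanD X Y : in_span X -> in_span Y -> in_span (X + Y).
Proof.
move=> [D1 [c1 [D1_gt0 E1]]] [D2 [c2 [D2_gt0 E2]]].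
exists (D1 * D2)%N, (fun i j => D2%:Z * c1 i j + D1%:Z * c2 i j).
split; first by rewrite muln_gt0 D1_gt0.
have -> : (D1 * D2)%:R * (X + Y) = D2%:R * (D1%:R * X) + D1%:R * (D2%:R * Y).
  by rewrite natrM; ring.
rewrite E1 E2 !mulr_sumr -big_split; apply: eq_bigr => i _ /=.
rewrite !mulr_sumr -big_split; apply: eq_bigr => j _ /=.
by rewrite rmorphD !rmorphM /= mulrDl !mulrA !pmulrn.
Qed.

Lemma in_span_int x X : is_int x -> in_span X -> in_span (x * X).
Proof.
move=> [z ->] [D [c [D_gt0 E]]]; exists D, (fun i j => z * c i j); split=> //.
rewrite mulrCA E mulr_sumr; apply: eq_bigr => i _.
rewrite mulr_sumr; apply: eq_bigr => j _.
by rewrite rmorphM mulrA.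
Qed.

Lemma in_spanN X : in_span X -> in_span (- X).
Proof. by rewrite -mulN1r; apply/in_span_int/is_intN/is_int1. Qed.

Lemma in_spanMn X k : in_span X -> in_span (X *+ k).
Proof. by rewrite -mulr_natl; apply/in_span_int/is_int_nat. Qed.

Lemma in_span0 : in_span 0.
Proof.
exists 1%N, (fun _ _ => 0); split=> //; rewrite mulr0 big1 // => i _.
by rewrite big1 // => j _; rewrite mul0r.
Qed.

(** To divide by an integer, its absolute value goes into the denominator and its sign into the
    coefficients. *)
Lemma in_span_cancel x X : is_int x -> x != 0 -> in_span (x * X) -> in_span X.
Proof.
move=> [z ->] z0 [D [c [D_gt0 E]]].
exists (D * `|z|)%N, (fun i j => Num.sg z * c i j); split.
  by rewrite muln_gt0 D_gt0 absz_gt0; apply: contra z0 => /eqP ->.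
have -> : (D * `|z|)%:R * X = (Num.sg z)%:~R * (D%:R * (z%:~R * X)).
  rewrite natrM (pmulrn 1 `|z|%N) abszE Num.Theory.normrEsg rmorphM; ring.
rewrite E mulr_sumr; apply: eq_bigr => i _.
by rewrite mulr_sumr; apply: eq_bigr => j _; rewrite rmorphM mulrA.
Qed.

Lemma in_span_gen i j : (i <= j)%N -> (i + j <= r)%N -> (j < r)%N ->
  in_span (U i j).
Proof.
move=> ij ijr jr; have ir := leq_ltn_trans ij jr.
exists 1%N, (fun i' j' => ((i' == i) && (j' == j))%:R); split=> //.
rewrite mul1r (bigD1 (Ordinal ir)) //= (bigD1 (Ordinal jr)) /= ?ij ?ijr //.
rewrite !eqxx mul1r !big1 ?addr0 // => [i' /negPf ni|j' /andP[_ /negPf nj]].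
  rewrite big1 // => j' _; rewrite -val_eqE /= in ni; by rewrite ni mul0r.
by rewrite -val_eqE /= in nj; rewrite nj andbF mul0r.
Qed.

(** Back from a common denominator to rational coefficients; [f] is any map sending z / D to a
    solution y of D y = z. *)
Lemma in_span_rat (f : rat -> V) X :
    (forall (z : int) D, (0 < D)%N -> D%:R * f (z%:~R / D%:R) = z%:~R) ->
  in_span X -> exists c : nat -> nat -> rat, X =
    \sum_(i < r) \sum_(j < r | ((i <= j) && (i + j <= r))%N) f (c i j) * U i j.
Proof.
move=> fE [D [c [D_gt0 E]]]; exists (fun i j => (c i j)%:~R / D%:R).
apply: (@mulfI _ D%:R); first by rewrite natV -lt0n.
rewrite E mulr_sumr; apply: eq_bigr => i _; rewrite mulr_sumr.
by apply: eq_bigr => j _; rewrite mulrA fE.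
Qed.

End RationalSpan.

(** * Homogeneous forms and transvectants *)

Section EulerForms.

Variable (R : comNzRingType).
Implicit Types F : {mpoly R[2]}.

Lemma euler_formZ N (c : R) F : euler_form N F -> euler_form N (c *: F).
Proof.
by rewrite /euler_form => EF; rewrite !mderivZ -!scalerAr -scalerDr EF.
Qed.

Lemma euler_form_sum N (I : finType) (F : I -> {mpoly R[2]}) :
  (forall i, euler_form N (F i)) -> euler_form N (\sum_i F i).
Proof.
move=> EF; rewrite /euler_form !raddf_sum /= !mulr_sumr -big_split /=.
by apply: eq_bigr => i _; rewrite EF.
Qed.

Lemma euler_form_monomial a b :
  euler_form (a + b) ('X_x1 ^+ a * 'X_x2 ^+ b : {mpoly R[2]}).
Proof.
rewrite /euler_form !mpolyXn -mpolyXD !mulX_mderivX -mulrDl -natrD.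
by rewrite !mnmDE !mulmnE !mnm1E /= !mul0n !mul1n addn0 add0n.
Qed.

End EulerForms.

Lemma transvectant_omega (R : comUnitRingType) p q k (F G : {mpoly R[2]}) :
    (forall k, (0 < k)%N -> (k%:R : R) \is a GRing.unit) ->
  (p`! * q`!)%:R * transvectant p q k F G =
  ((p - k)`! * (q - k)`!)%:R * omega k F G.
Proof.
move=> unitR; rewrite /transvectant.
have -> : \sum_(l < k.+1) ((-1) ^+ l * 'C(k, l)%:R : R) *:
     (F^`M[U_(x1) *+ (k - l) + U_(x2) *+ l] *
      G^`M[U_(x1) *+ l + U_(x2) *+ (k - l)]) = omega k F G.
  apply: eq_bigr => l _; rewrite -mul_mpolyC rmorphM /= mpolyC_nat.
  by rewrite rmorphXn rmorphN1.
rewrite -[_ *: omega _ _ _]mul_mpolyC mulrA; congr (_ * _).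
rewrite -!mpolyC_nat -rmorphM /= mulrC divrK //.
by rewrite unitR // muln_gt0 !fact_gt0.
Qed.

(** * Solving for u_0 u_r *)

Section ProductInSpan.

Variables (R : idomainType) (A B : {mpoly R[2]}) (m n r : nat).
Hypotheses (Am : euler_form m A) (Bn : euler_form n B).
Hypothesis unitR : forall k, (0 < k)%N -> (k%:R : R) \is a GRing.unit.
Hypotheses (r2 : (2 <= r)%N) (rm : (r <= m)%N) (rn : (r <= n)%N).

Local Notation Phi := (sym4 A B A B).

Let U i j := transvectant (m + n - 2 * i) (m + n - 2 * j) (r - i - j)
  (transvectant m n i A B) (transvectant m n j A B).

Local Notation spanned := (in_span U r).

Lemma natr_mpoly_eq0 k : (k%:R == 0 :> {mpoly R[2]}) = (k == 0%N).
Proof.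
rewrite -mpolyC_nat mpolyC_eq0; case: k => [|k]; first by rewrite !eqxx.
apply/negbTE/eqP => k0; have := @unitR k.+1 isT.
by rewrite k0 unitr0.
Qed.

Lemma omega_nat k a b (F G : {mpoly R[2]}) :
  omega k (a%:R * F) (b%:R * G) = (a * b)%:R * omega k F G.
Proof.
by rewrite -!mpolyC_nat !mul_mpolyC omegaZ natrM.
Qed.

Lemma spanned_brsum_le i j k : (i <= j)%N -> (j < r)%N -> (i + j + k)%N = r ->
  spanned (Phi (br12 ^+ i * br34 ^+ j * brsum ^+ k)).
Proof.
move=> ij jr ijk.
have Uij : spanned (U i j).
  by apply: in_span_gen => //; rewrite -ijk leq_addr.
set p := (m + n - 2 * i)%N; set q := (m + n - 2 * j)%N.
have kE : (r - i - j)%N = k by rewrite -ijk; lia.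
(* [c] collects the numerators of the prefactors of the three transvectants in [U i j]; their
   denominators appear on the other side. *)
pose c := (((p - k)`! * (q - k)`!) *
  (((m - i)`! * (n - i)`!) * ((m - j)`! * (n - j)`!)))%N.
apply: (@in_span_cancel _ _ _ c%:R).
- exact: is_int_nat.
- by rewrite natr_mpoly_eq0 -lt0n !muln_gt0 !fact_gt0.
have -> : c%:R * Phi (br12 ^+ i * br34 ^+ j * brsum ^+ k) =
    ((m`! * n`!) * (m`! * n`!) * (p`! * q`!))%:R * U i j.
  rewrite natrM -[RHS]mulrA /U kE transvectant_omega // mulrCA -omega_nat.
  rewrite !transvectant_omega // omega_nat omega_omega.
  by rewrite mulrA -natrM.
by apply: in_span_int => //; apply: is_int_nat.
Qed.

Lemma spanned_brsum i j k : (i < r)%N -> (j < r)%N -> (i + j + k)%N = r ->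
  spanned (Phi (br12 ^+ i * br34 ^+ j * brsum ^+ k)).
Proof.
move=> ir jr ijk; case/orP: (leq_total i j) => le_ij.
  exact: spanned_brsum_le.
rewrite sym4_brsum_sym; apply: in_span_int.
  by exists ((-1) ^+ k); rewrite rmorphXn rmorphN1.
by apply: spanned_brsum_le => //; rewrite addnAC addnC addnA in ijk *; lia.
Qed.

Lemma natrB_mpoly a i : (i <= a)%N ->
  a%:R - i%:R = (a - i)%:R :> {mpoly R[2]}.
Proof. by move=> ia; rewrite natrB. Qed.

Lemma falling_neq0 a i k : (i + k <= a)%N ->
  falling (a%:R - i%:R : {mpoly R[2]}) k != 0.
Proof.
elim: k i => [|k IHk] i ika /=; first exact: oner_neq0.
rewrite mulf_neq0 //.
  by rewrite natrB_mpoly ?natr_mpoly_eq0; lia.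
by rewrite -addrA -opprD -(natrD _ i 1); apply: IHk; lia.
Qed.

Let X i j := Phi (br12 ^+ i * br34 ^+ j * (br13 * br24)).

(* The last two terms lie in the span unless i = 0, resp. j = 0, where they are
   multiples of u_0 u_r; hence the care for d and e. *)
Lemma X_relation i j : (i + j + 2)%N = r ->
  exists c d e : {mpoly R[2]},
  [/\ [/\ is_int c, is_int d & is_int e], c != 0, d != 0, i = j -> d = e &
  exists2 Y, spanned Y &
    c * X i j = Y - d * Phi (br12 ^+ i * br34 ^+ (j + 2))
                  - e * Phi (br12 ^+ (i + 2) * br34 ^+ j)].
Proof.
move=> ijr.
have [ir jr i1r j1r] : [/\ i < r, j < r, i + 1 < r & j + 1 < r]%N by split; lia.
(* Since i + 2 and j + 2 are at most r, every letter keeps order at least 2, so the factors [p],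
   [p - 1], etc. are nonzero. *)
have [mi ni mj nj] : [/\ 2 <= m - i, 2 <= n - i, 2 <= m - j & 2 <= n - j]%N.
  by split; lia.
pose p : {mpoly R[2]} := m%:R - i%:R; pose q : {mpoly R[2]} := n%:R - i%:R.
pose p' : {mpoly R[2]} := m%:R - j%:R; pose q' : {mpoly R[2]} := n%:R - j%:R.
have Ep : p = (m - i)%:R by rewrite /p natrB // ltnW // (leq_trans ir).
have Eq : q = (n - i)%:R by rewrite /q natrB // ltnW // (leq_trans ir).
have Ep' : p' = (m - j)%:R by rewrite /p' natrB // ltnW // (leq_trans jr).
have Eq' : q' = (n - j)%:R by rewrite /q' natrB // ltnW // (leq_trans jr).
have pqD : p + q = (m - i + (n - i))%:R by rewrite Ep Eq natrD.
have pqD' : p' + q' = (m - j + (n - j))%:R by rewrite Ep' Eq' natrD.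
have [nz1 nz2] : (forall a, (2 <= a)%N -> (a%:R : {mpoly R[2]}) - 1 != 0) /\
    (forall a, (3 <= a)%N -> (a%:R : {mpoly R[2]}) - 2 != 0).
  split=> a a_gt.
    by rewrite (natrB_mpoly (i := 1)) ?natr_mpoly_eq0; lia.
  by rewrite (natrB_mpoly (i := 2)) ?natr_mpoly_eq0; lia.
have nz0 a : (1 <= a)%N -> (a%:R : {mpoly R[2]}) != 0.
  by move=> a_gt; rewrite natr_mpoly_eq0; lia.
have int_p : is_int p by rewrite Ep; apply: is_int_nat.
have int_q : is_int q by rewrite Eq; apply: is_int_nat.
have int_p' : is_int p' by rewrite Ep'; apply: is_int_nat.
have int_q' : is_int q' by rewrite Eq'; apply: is_int_nat.
have K0 : p * (p - 1) * q * (q - 1) * p' * (p' - 1) * q' * (q' - 1) != 0.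
  by rewrite Ep Eq Ep' Eq' !mulf_neq0 ?nz0 ?nz1 // ltnW.
have := Psi_br13_br24 Am Bn (erefl p) (erefl q) (erefl p') (erefl q') K0.
rewrite /= -/brsum => relation.
have bracketsE a b k :
    Phi (br12 ^+ i * br34 ^+ j * (br12 ^+ a * br34 ^+ b * brsum ^+ k)) =
    Phi (br12 ^+ (i + a) * br34 ^+ (j + b) * brsum ^+ k).
  by rewrite !exprD !mulrA (mulrAC (br12 ^+ i)).
have := bracketsE 0%N 0%N 2%N; have := bracketsE 0%N 1%N 1%N.
have := bracketsE 1%N 0%N 1%N; have := bracketsE 0%N 2%N 0%N.
have := bracketsE 2%N 0%N 0%N; have := bracketsE 1%N 1%N 0%N.
rewrite !expr0 !expr1 !mul1r !mulr1 => E11 E20 E02 E10 E01 E00.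
rewrite E11 E20 E02 E10 E01 E00 in relation.
(* The terms in [34]^2 and [12]^2, which may leave the span, are moved to the end. *)
have rearrange (x1' x2' x3 x4 x5 x6 : {mpoly R[2]}) :
    x1' + x2' - x3 - x4 - x5 + x6 = x1' + x2' - x3 + x6 - x4 - x5 by ring.
rewrite rearrange in relation; rewrite !addn0 in relation.
have spannedT a b k : (i + a < r)%N -> (j + b < r)%N -> (a + b + k)%N = 2 ->
    spanned (Phi (br12 ^+ (i + a) * br34 ^+ (j + b) * brsum ^+ k)).
  by move=> ia jb abk; apply: spanned_brsum => //; lia.
have S00 := spannedT 0%N 0%N 2%N; have S01 := spannedT 0%N 1%N 1%N.
have S10 := spannedT 1%N 0%N 1%N; have S11 := spannedT 1%N 1%N 0%N.
rewrite ?addn0 ?expr0 ?expr1 ?mulr1 in S00 S01 S10 S11.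
pose P := p + q; pose P' := p' + q'.
(* The witnesses are the coefficients of [13][24], [34]^2 and [12]^2 in [Psi_br13_br24]. *)
exists (P * (P - 1) * (P - 2) * (P' * (P' - 1) * (P' - 2))),
  (p * q * P * (P - 1) * (P - 2) * P'),
  (p' * q' * P * P' * (P' - 1) * (P' - 2)).
have int_P : is_int P by apply: is_intD.
have int_P' : is_int P' by apply: is_intD.
have intB1 (x : {mpoly R[2]}) : is_int x -> is_int (x - 1).
  by move=> x_int; apply/is_intD/is_intN/is_int1.
have intB2 (x : {mpoly R[2]}) : is_int x -> is_int (x - 2).
  by move=> x_int; apply/is_intD/is_intN/(is_int_nat _ 2).
have [int_P1 int_P2] := (intB1 _ int_P, intB2 _ int_P).
have [int_P'1 int_P'2] := (intB1 _ int_P', intB2 _ int_P').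
have [P_neq0 P1_neq0 P2_neq0] : [/\ P != 0, P - 1 != 0 & P - 2 != 0].
  have P4 : (4 <= m - i + (n - i))%N by apply: (leq_add mi ni).
  by rewrite /P pqD; split; [apply: nz0|apply: nz1|apply: nz2];
    apply: leq_trans P4.
have [P'_neq0 P'1_neq0 P'2_neq0] : [/\ P' != 0, P' - 1 != 0 & P' - 2 != 0].
  have P4 : (4 <= m - j + (n - j))%N by apply: (leq_add mj nj).
  by rewrite /P' pqD'; split; [apply: nz0|apply: nz1|apply: nz2];
    apply: leq_trans P4.
have [p_neq0 q_neq0] : p != 0 /\ q != 0.
  by rewrite Ep Eq; split; apply: nz0; apply: ltnW.
split.
- by split; do ?apply: is_intM.
- by rewrite !mulf_neq0.
- by rewrite !mulf_neq0.
- move=> ij; have [pp' qq'] : p = p' /\ q = q' by rewrite /p /q ij.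
  rewrite /P /P' pp' qq'.
  by move: (p') (q') => x y; ring.
eexists; last exact: relation.
have int_pq : is_int (p - q) by apply/is_intD/is_intN.
apply: in_spanD; [apply: in_spanD; [apply: in_spanD|apply: in_spanN]|];
  apply: in_span_int.
- by do ?apply: is_intM.
- exact: S00.
- by do ?apply: is_intM.
- exact: S01.
- by do ?apply: is_intM.
- exact: S10.
- apply: is_intM; last by do ?apply: is_intM.
  by apply/is_intD/is_intM/is_intD => //; apply/is_intMn/is_intM.
- exact: S11.
Qed.

Variable k : nat.
Hypothesis kr : (k + 2)%N = r.

(** The binomial expansion of the antisymmetric symbol. In its l-th term the values a_x contribute
    falling factorials, collected in the weight [w l]. *)
Lemma weighted_sum_X_eq0 : exists w : nat -> {mpoly R[2]},
  [/\ forall l, is_int (w l), forall l, (l <= k)%N -> w l != 0, w 0%N = w k &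
   \sum_(l < k.+1) (w l * X (k - l) l) *+ 'C(k, l) = 0].
Proof.
(* Beside [12]^(k-l) [34]^l, the brackets [13] and [24] add one to the degree in each letter; hence
   the successors. *)
exists (fun l => falling (m%:R - (k - l).+1%:R) l *
  falling (n%:R - (k - l).+1%:R) l * falling (m%:R - l.+1%:R) (k - l) *
  falling (n%:R - l.+1%:R) (k - l)).
have int_falling a b l : is_int (falling (a%:R - b%:R : {mpoly R[2]}) l).
  by apply/is_int_falling/is_intD/is_intN/is_int_nat/is_int_nat.
split=> [l|l lk||].
- by do ?apply: is_intM.
- have [km kn] : (k < m)%N /\ (k < n)%N.
    have kr1 : (k < r)%N by rewrite -kr addn2.
    by split; [apply: leq_trans rm|apply: leq_trans rn].
  by rewrite !mulf_neq0 // falling_neq0 // ?addSn ?subnK // addnC subnK.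
- by rewrite subn0 subnn /= !mul1r !mulr1.
have /eqP := sym4_antisym A B k.
rewrite -[X in X == 0](mulr_natr _ 2) mulf_eq0 natr_mpoly_eq0 orbF => /eqP.
rewrite exprDn mulr_sumr (raddf_sum Phi) => {2}<-.
apply: eq_bigr => l _; have lk : (l <= k)%N by rewrite -ltnS.
rewrite [in RHS]mulrnAr (raddfMn Phi); congr (_ *+ _).
have := multidegreeM (multidegreeM (multidegreeX (k - l) multidegree_br12)
  (multidegreeX l multidegree_br34))
  (multidegreeM multidegree_br13 multidegree_br24).
rewrite !muln0 !muln1 !addn0 !add0n !addn1 => /(sym4_ev Am Bn l l (k - l) (k -
  l)).
rewrite /X => <-; apply: (congr1 Phi); rewrite !exprMn.
move: (br12) (br34) (br13) (br24) (ev1) (ev2) (ev3) (ev4) => *; ring.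
Qed.

(** For positive i and j the exponents i + 2 and j + 2 stay below r, so the last two terms of
    [X_relation] are in the span as well. *)
Lemma spanned_X i j : (i + j + 2)%N = r -> (0 < i)%N -> (0 < j)%N ->
  spanned (X i j).
Proof.
move=> ijr i_gt0 j_gt0.
have [c [d [e [[c_int d_int e_int] c0 _ _ [Y Ysp E]]]]] := X_relation ijr.
have T1 := @spanned_brsum i (j + 2) 0; have T2 := @spanned_brsum (i + 2) j 0.
rewrite ?expr0 ?mulr1 in T1 T2.
apply: (in_span_cancel c_int c0); rewrite E.
apply: in_spanD; [apply: in_spanD => //|]; apply/in_spanN/in_span_int => //.
  by apply: T1; lia.
by apply: T2; lia.
Qed.

(** In the weighted relation the interior terms are spanned. The two end terms are equal by symmetry
    and carry the same weight, so they add up instead of cancelling. *)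
Lemma spanned_X0 : spanned (X 0 k).
Proof.
have [w [w_int w_neq0 w0k]] := weighted_sum_X_eq0.
(* For k = 0 the sum has a single term, and [X 0 0] vanishes. *)
have [k0|k_gt0] := posnP k.
  rewrite k0 big_ord1 bin0 mulr1n subn0 => /eqP.
  by rewrite mulf_eq0 (negPf (w_neq0 _ _)) //= => /eqP ->; apply: in_span0.
have := @binomial_sum_ends {mpoly R[2]} k (fun l => w l * X (k - l) l) k_gt0.
rewrite (subn0 k) (subnn k) w0k.
have -> : X k 0%N = X 0 k by apply: sym4_br1324_sym.
move=> -> E.
apply: (in_span_cancel (x := w k *+ 2)).
- exact: is_intMn.
- by rewrite -mulr_natr mulf_neq0 ?w_neq0 // natr_mpoly_eq0.
have double (a b : {mpoly R[2]}) : a + b + a = 0 -> a *+ 2 = - b.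
  by move/eqP; rewrite addrAC addr_eq0 -mulr2n => /eqP.
rewrite mulrnAl (double _ _ E); apply/in_spanN; rewrite big_nat.
apply: big_ind => [||l /andP[l_gt0 lk]]; [exact: in_span0|exact: in_spanD|].
apply/in_spanMn/in_span_int => //; apply: spanned_X => //; last lia.
by rewrite subnK // ltnW.
Qed.

(** [X_relation] with i = 0 and j = k is solved for [34]^r, the symbol of u_0 u_r up to a factor. *)
Lemma spanned_br34 : spanned (Phi (br12 ^+ 0 * br34 ^+ r)).
Proof.
have kr0 : (0 + k + 2)%N = r by [].
have [c [d [e [[c_int d_int e_int] c0 d0 de [Y Ysp E]]]]] := X_relation kr0.
have Esp : spanned (d * Phi (br12 ^+ 0 * br34 ^+ r) +
                    e * Phi (br12 ^+ 2 * br34 ^+ k)).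
  have -> : d * Phi (br12 ^+ 0 * br34 ^+ r) + e * Phi (br12 ^+ 2 * br34 ^+ k) =
      Y - c * X 0 k by rewrite E -{1}kr; move: (Phi _) (Phi _) => *; ring.
  by apply/in_spanD/in_spanN/in_span_int/spanned_X0.
(* If k = 0, then [12]^2 and [34]^2 have equal values and d = e, so the coefficient is 2d and
   nonzero. If k > 0, the term [12]^2 [34]^k is already spanned. *)
have [k0|k_gt0] := posnP k.
  have T2 := sym4_brsum_sym A B 2 0 0; rewrite !expr0 !mulr1 mul1r in T2.
  have r2E : r = 2%N by rewrite -kr k0.
  move: Esp; rewrite k0 r2E expr0 mulr1 T2 -mulrDl -de ?k0 //.
  apply: in_span_cancel; first exact: is_intD.
  by rewrite -mulr2n -(mulr_natr d 2) mulf_neq0 // natr_mpoly_eq0.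
have T2 := @spanned_brsum 2 k 0; rewrite expr0 mulr1 in T2.
apply: (in_span_cancel d_int d0).
rewrite -[X in spanned X](addrK (e * Phi (br12 ^+ 2 * br34 ^+ k))).
by apply: in_spanD => //; apply/in_spanN/in_span_int => //; apply: T2; lia.
Qed.

Lemma omega0 (F G : {mpoly R[2]}) : omega 0 F G = F * G.
Proof. by rewrite /omega big_ord1 !pd00 expr0 bin0 !mul1r. Qed.

Lemma spanned_product :
  spanned (transvectant m n 0 A B * transvectant m n r A B).
Proof.
pose N := (m`! * n`!)%N.
have N_gt0 : (0 < N)%N by rewrite muln_gt0 !fact_gt0.
apply: (@in_span_cancel _ _ _ (N * N)%:R).
- exact: is_int_nat.
- by rewrite natr_mpoly_eq0 -lt0n muln_gt0 N_gt0.
rewrite natrM mulrACA !transvectant_omega // mulrACA -natrM.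
apply: in_span_int; first exact: is_int_nat.
rewrite -[X in spanned X]omega0 omega_omega mulr1.
exact: spanned_br34.
Qed.

Lemma product_rational (f : rat -> R) :
    (forall (z : int) D, (0 < D)%N -> D%:R * f (z%:~R / D%:R) = z%:~R) ->
  exists c : nat -> nat -> rat,
    transvectant m n 0 A B * transvectant m n r A B =
    \sum_(i < r) \sum_(j < r | ((i <= j) && (i + j <= r))%N)
      f (c i j) *: U i j.
Proof.
move=> fE.
have fE' (z : int) D : (0 < D)%N ->
    D%:R * (f (z%:~R / D%:R))%:MP = z%:~R :> {mpoly R[2]}.
  by move=> D_gt0; rewrite -mpolyC_nat -rmorphM /= fE // rmorph_int.
have [c ->] := in_span_rat natr_mpoly_eq0 (f := fun q => (f q)%:MP) fE'
  spanned_product; exists c.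
by apply: eq_bigr => i _; apply: eq_bigr => j _; rewrite mul_mpolyC.
Qed.

Lemma transvectant0_neq0 : A != 0 -> B != 0 -> transvectant m n 0 A B != 0.
Proof.
move=> A0 B0; apply: contraTneq (mulf_neq0 A0 B0) => u0.
have := @transvectant_omega _ m n 0 A B unitR; rewrite u0 mulr0 omega0.
set c := (_ * _)%N; rewrite negbK => /esym/eqP;
  rewrite (mulf_eq0 c%:R) => /orP[|//].
by rewrite natr_mpoly_eq0 /c -leqn0 leqNgt muln_gt0 !fact_gt0.
Qed.

End ProductInSpan.

(** * Generic forms and passage to the field of fractions *)

Section GenericForms.

Variables (K : fieldType) (m n : nat).
Hypothesis charK0 : [pchar K] =i pred0.

Lemma natrK_eq0 k : (k%:R == 0 :> K) = (k == 0%N).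
Proof. by move/pcharf0P: charK0 => ->. Qed.

Lemma natr_coefRing_unit k : (0 < k)%N -> (k%:R : coefRing K m n) \is a
  GRing.unit.
Proof.
move=> k_gt0; rewrite -(mpolyC_nat _ _ k); apply: rmorph_unit.
by rewrite unitfE natrK_eq0 -lt0n.
Qed.

Lemma euler_genA : euler_form m (genA K m n).
Proof.
apply: euler_form_sum => k; apply: euler_formZ.
rewrite -[X in euler_form X](subnK (leq_ord k)); exact: euler_form_monomial.
Qed.

Lemma euler_genB : euler_form n (genB K m n).
Proof.
apply: euler_form_sum => k; apply: euler_formZ.
rewrite -[X in euler_form X](subnK (leq_ord k)); exact: euler_form_monomial.
Qed.

(** The coefficient of x_1^N is [a ord0], as every other term contains x_2. *)
Lemma generic_form_neq0 (R : comNzRingType) N (a : 'I_N.+1 -> R) : a ord0 != 0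
  ->
  \sum_(k < N.+1) ('C(N, k)%:R * a k) *: ('X_x1 ^+ (N - k) * 'X_x2 ^+ k)
    != 0 :> {mpoly R[2]}.
Proof.
apply: contraNneq => /(congr1 (mcoeff (U_(x1) *+ N))).
rewrite mcoeff0 raddf_sum (bigD1 ord0) //= big1 ?addr0 => [|k k0].
  rewrite subn0 mulr1 mpolyXn mcoeffZ mcoeffX eqxx bin0 mul1r mulr1.
  by move=> ->.
rewrite !mpolyXn -mpolyXD mcoeffZ mcoeffX; case: eqP => [|_]; last
  by rewrite mulr0.
move/(congr1 (fun M : 'X_{1..2} => M x2)).
rewrite mnmDE !mulmnE !mnm1E /= !mul0n mul1n add0n => k_eq0.
by move: k0; rewrite -val_eqE /= k_eq0.
Qed.

Lemma genA_neq0 : genA K m n != 0.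
Proof. by apply: generic_form_neq0; rewrite /coefA -msupp_eq0 msuppX. Qed.

Lemma genB_neq0 : genB K m n != 0.
Proof. by apply: generic_form_neq0; rewrite /coefB -msupp_eq0 msuppX. Qed.

End GenericForms.

(** [ratr] is computed from the reduced fraction; in characteristic zero no denominator vanishes,
    and cross-multiplication compares it with the given one. *)
Lemma ratr_frac (F : fieldType) (a : int) (b : nat) : [pchar F] =i pred0 ->
  (0 < b)%N -> ratr (a%:~R / b%:R) = a%:~R / b%:R :> F.
Proof.
move=> charF0 b_gt0; set x : rat := a%:~R / b%:R.
have natF k : (k%:R == 0 :> F) = (k == 0%N) by move/pcharf0P: charF0 => ->.
have den_neq0 : (denq x)%:~R != 0 :> F.
  by rewrite -(gez0_abs (ltW (denq_gt0 x))) -pmulrn natF absz_eq0 denq_neq0.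
rewrite /ratr; apply/eqP; rewrite eqr_div // ?natF -?lt0n //.
rewrite (pmulrn 1 b) -!rmorphM /=; apply/eqP; congr (_%:~R).
apply: (@intr_inj rat); rewrite !rmorphM /=.
have b_neq0 : b%:~R != 0 :> rat by rewrite -pmulrn pnatr_eq0 -lt0n.
apply/eqP; rewrite -eqr_div ?intr_eq0 ?denq_neq0 //; last first.
  by rewrite -(intr_eq0 rat).
by rewrite divq_num_den.
Qed.

Theorem theorem1p2 (K : fieldType) (charK0 : [pchar K] =i pred0)
    (m n r : nat) (hm : (2 <= m)%N) (hn : (2 <= n)%N) (hr : (2 <= r)%N)
    (hrmn : (r <= minn m n)%N) :
  exists c : nat -> nat -> rat,
    tofrac (u_ K m n r) =
    (tofrac (u_ K m n 0))^-1 *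
    tofrac (\sum_(i < r) \sum_(j < r | ((i <= j) && (i + j <= r))%N)
              ratC K m n (c i j) *: uu_ K m n i j (r - i - j)).
Proof.
have [rm rn] : (r <= m)%N /\ (r <= n)%N by apply/andP; rewrite -leq_min.
have unitR := natr_coefRing_unit m n charK0.
have Am := euler_genA K m n; have Bn := euler_genB K m n.
have ratCE (z : int) D : (0 < D)%N ->
    D%:R * ratC K m n (z%:~R / D%:R) = z%:~R.
  move=> D_gt0; rewrite /ratC ratr_frac // -mpolyC_nat -rmorphM /=.
  by rewrite mulrCA divff ?mulr1 ?rmorph_int // natrK_eq0 // -lt0n.
(* Here [k] is r - 2, by [subnK hr]. *)
have [c E] := product_rational Am Bn unitR hr rm rn (subnK hr) ratCE.
exists c.
have u0_neq0 : u_ K m n 0 != 0.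
  by apply: (transvectant0_neq0 _ _ unitR); [apply: genA_neq0|apply: genB_neq0].
set S := \sum_(i < r) _.
have -> : S = u_ K m n 0 * u_ K m n r by exact: esym E.
rewrite rmorphM; move: (u_ K m n r) => ur.
by rewrite mulKf ?tofrac_eq0.
Qed.
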